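(* The following two categories are isomorphic: (a) The category of all left ditrusses $(T,+,-,0,\sigma,\circ,\cdot)$ with $\circ$ associative, with $\lambda^T\colon (T,\circ)\to \operatorname{End}_{\mathsf{Gp}}(T,+)$ a constant semigroup morphism, and with $\sigma$ and $\lambda^T_0$ image-commuting idempotent endomorphisms of the group $(T,+,-,0)$. (b) The category of all associative interchange near-rings.
   Context: A left ditruss is an algebra $(T,+,-,0,\sigma,\circ,\cdot)$, where $+,\circ,\cdot$ are binary operations, $-$ and $\sigma$ are unary and $0$ is nullary, such that $(T,+,-,0)$ is a (not necessarily abelian) group and $\sigma(a)+a\cdot b=a\circ b$ for all $a,b\in T$. Left ditruss morphisms are the mappings that preserve all these operations. For $a\in T$, $\lambda^T_a\colon T\to T$ denotes the mapping $\lambda^T_a(b)=a\cdot b$, and $\lambda^T$ denotes the mapping $a\mapsto\lambda^T_a$. $\operatorname{End}_{\mathsf{Gp}}(T,+)$ is the semigroup (under composition) of all group endomorphisms of $(T,+)$; the requirement that $\lambda^T\colon (T,\circ)\to \operatorname{End}_{\mathsf{Gp}}(T,+)$ is a constant semigroup morphism means that every $\lambda^T_a$ is a group endomorphism of $(T,+)$, that $\lambda^T$ is a semigroup morphism from $(T,\circ)$, and that $\lambda^T_a=\lambda^T_b$ for all $a,b\in T$. Two endomorphisms $\varepsilon,\eta$ of an additive group $G$ are image-commuting if $\varepsilon(x)+\eta(y)=\eta(y)+\varepsilon(x)$ for all $x,y\in G$. An interchange near-ring $(G,+,-,0_G,\circ)$ is a (not necessarily abelian) group $(G,+,-,0_G)$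 with a further binary operation $\circ$ such that $(w+x)\circ(y+z)=(w\circ y)+(x\circ z)$ for all $w,x,y,z\in G$. It is associative if the operation $\circ$ is associative. Morphisms of interchange near-rings are the mappings preserving $+$ and $\circ$. Both categories are understood with all left ditruss morphisms, respectively all interchange near-ring morphisms, between their objects. *)

(* Defs.v *)
From Stdlib Require Import ProofIrrelevance.
From mathcomp Require Import ssreflect ssrfun ssrbool.

Set Implicit Arguments.
Unset Strict Implicit.
Unset Printing Implicit Defensive.

(* Categories, functors and isomorphism of categories.  Equality of objects,
   morphisms and functors is Leibniz equality, so [isomorphic_categories] is
   strict isomorphism, not equivalence. *)

Record category := Category {
  obj :> Type;
  hom : obj -> obj -> Type;
  idm : forall A, hom A A;
  compm : forall A B C, hom B C -> hom A B -> hom A C;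
  compm_idl : forall A B (f : hom A B), compm (idm B) f = f;
  compm_idr : forall A B (f : hom A B), compm f (idm A) = f;
  compmA : forall A B C D (h : hom C D) (g : hom B C) (f : hom A B),
    compm h (compm g f) = compm (compm h g) f }.

Arguments idm {c} A.
Arguments compm {c A B C} g f.

Record functor (C D : category) := Functor {
  fobj :> C -> D;
  fmap : forall A B : C, hom A B -> hom (fobj A) (fobj B);
  fmap_id : forall A : C, fmap (idm A) = idm (fobj A);
  fmap_comp : forall (X Y Z : C) (g : hom Y Z) (f : hom X Y),
    fmap (compm g f) = compm (fmap g) (fmap f) }.

Arguments fmap {C D} F {A B} f : rename.

Definition functor_id (C : category) : functor C C :=
  @Functor C C (fun A => A) (fun A B f => f)
    (fun A => erefl) (fun X Y Z g f => erefl).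

Lemma functor_comp_id (C D E : category) (G : functor D E) (F : functor C D)
  (A : C) : fmap G (fmap F (idm A)) = idm (G (F A)).
Proof. by rewrite !fmap_id. Qed.

Lemma functor_comp_comp (C D E : category) (G : functor D E) (F : functor C D)
  (X Y Z : C) (g : hom Y Z) (f : hom X Y) :
  fmap G (fmap F (compm g f)) = compm (fmap G (fmap F g)) (fmap G (fmap F f)).
Proof. by rewrite !fmap_comp. Qed.

Definition functor_comp (C D E : category) (G : functor D E) (F : functor C D) :
    functor C E :=
  @Functor C E (fun A => G (F A)) (fun A B f => fmap G (fmap F f))
    (functor_comp_id G F) (functor_comp_comp G F).

Definition isomorphic_categories (C D : category) : Prop :=
  exists (F : functor C D) (G : functor D C),
    functor_comp G F = functor_id C /\ functor_comp F G = functor_id D.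

Definition full_subcategory (C : category) (P : C -> Prop) : category :=
  @Category {A : C | P A} (fun A B => hom (sval A) (sval B))
    (fun A => idm (sval A)) (fun A B D g f => compm g f)
    (fun A B f => compm_idl f) (fun A B f => compm_idr f)
    (fun A B D E h g f => compmA h g f).

(* Not necessarily abelian additive groups on arbitrary carriers.  MathComp's
   [groupType] is not used because its objects also carry a choice operator,
   and its [zmodType] is commutative. *)

Record group := Group {
  carrier :> Type;
  add : carrier -> carrier -> carrier;
  opp : carrier -> carrier;
  zero : carrier;
  addA : associative add;
  add0l : left_id zero add;
  add0r : right_id zero add;
  addNl : left_inverse zero opp add;
  addNr : right_inverse zero opp add }.

Arguments add {g} x y.
Arguments opp {g} x.
Arguments zero {g}.

Declare Scope agroup_scope.
Delimit Scope agroup_scope with A.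
Notation "x + y" := (add x y) : agroup_scope.
Notation "- x" := (opp x) : agroup_scope.
Notation "0" := zero : agroup_scope.
Local Open Scope agroup_scope.

Definition group_endomorphism (G : group) (e : G -> G) : Prop :=
  forall x y : G, e (x + y) = e x + e y.

Definition image_commuting (G : group) (e h : G -> G) : Prop :=
  forall x y : G, e x + h y = h y + e x.

Definition idempotent_endomorphism (G : group) (e : G -> G) : Prop :=
  group_endomorphism e /\ idempotent_fun e.

Record left_ditruss := LeftDitruss {
  ditruss_group :> group;
  sigma : ditruss_group -> ditruss_group;
  tcirc : ditruss_group -> ditruss_group -> ditruss_group;
  tdot : ditruss_group -> ditruss_group -> ditruss_group;
  ditrussE : forall a b : ditruss_group, sigma a + tdot a b = tcirc a b }.

Arguments sigma {l} a.
Arguments tcirc {l} a b.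
Arguments tdot {l} a b.

Record ditruss_morphism (S T : left_ditruss) (f : S -> T) : Prop :=
  DitrussMorphism {
  dm_add : forall a b : S, f (a + b) = f a + f b;
  dm_opp : forall a : S, f (- a) = - f a;
  dm_zero : f 0 = 0;
  dm_sigma : forall a : S, f (sigma a) = sigma (f a);
  dm_circ : forall a b : S, f (tcirc a b) = tcirc (f a) (f b);
  dm_dot : forall a b : S, f (tdot a b) = tdot (f a) (f b) }.

Record interchange_near_ring := InterchangeNearRing {
  near_ring_group :> group;
  ncirc : near_ring_group -> near_ring_group -> near_ring_group;
  ncirc_interchange : forall w x y z : near_ring_group,
    ncirc (w + x) (y + z) = ncirc w y + ncirc x z }.

Arguments ncirc {i} x y.

Record near_ring_morphism (G H : interchange_near_ring) (f : G -> H) : Prop :=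
  NearRingMorphism {
  nm_add : forall x y : G, f (x + y) = f x + f y;
  nm_circ : forall x y : G, f (ncirc x y) = ncirc (f x) (f y) }.

Definition ditruss_hom (S T : left_ditruss) : Type :=
  {f : S -> T | ditruss_morphism f}.

Definition near_ring_hom (G H : interchange_near_ring) : Type :=
  {f : G -> H | near_ring_morphism f}.

Lemma ditruss_morphism_id (T : left_ditruss) :
  ditruss_morphism (fun x : T => x).
Proof. by split. Qed.

Lemma ditruss_morphism_comp (S T V : left_ditruss) (g : T -> V) (f : S -> T) :
  ditruss_morphism g -> ditruss_morphism f -> ditruss_morphism (g \o f).
Proof.
move=> [gD gN g0 gs gc gd] [fD fN f0 fs fc fd].
by split=> * /=; rewrite ?fD ?fN ?f0 ?fs ?fc ?fd.
Qed.

Lemma near_ring_morphism_id (G : interchange_near_ring) :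
  near_ring_morphism (fun x : G => x).
Proof. by split. Qed.

Lemma near_ring_morphism_comp (G H K : interchange_near_ring) (g : H -> K) (f : G -> H) :
  near_ring_morphism g -> near_ring_morphism f -> near_ring_morphism (g \o f).
Proof.
by move=> [gD gc] [fD fc]; split=> * /=; rewrite ?fD ?fc.
Qed.

Definition ditruss_id (T : left_ditruss) : ditruss_hom T T :=
  exist _ (fun x : T => x) (ditruss_morphism_id T).

Definition ditruss_comp (S T V : left_ditruss) (g : ditruss_hom T V)
    (f : ditruss_hom S T) : ditruss_hom S V :=
  exist _ (sval g \o sval f) (ditruss_morphism_comp (svalP g) (svalP f)).

Definition near_ring_id (G : interchange_near_ring) : near_ring_hom G G :=
  exist _ (fun x : G => x) (near_ring_morphism_id G).

Definition near_ring_comp (G H K : interchange_near_ring) (g : near_ring_hom H K)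
    (f : near_ring_hom G H) : near_ring_hom G K :=
  exist _ (sval g \o sval f) (near_ring_morphism_comp (svalP g) (svalP f)).

Lemma sig_eq (A : Type) (P : A -> Prop) (u v : {x : A | P x}) :
  sval u = sval v -> u = v.
Proof.
case: u v => [x px] [y py] /= e; case: y / e py => py.
by rewrite (proof_irrelevance _ px py).
Qed.

Definition DitrussCat : category :=
  @Category left_ditruss ditruss_hom ditruss_id ditruss_comp
    (fun A B f => @sig_eq _ _ (ditruss_comp (ditruss_id B) f) f erefl)
    (fun A B f => @sig_eq _ _ (ditruss_comp f (ditruss_id A)) f erefl)
    (fun A B C D h g f =>
       @sig_eq _ _ (ditruss_comp h (ditruss_comp g f))
         (ditruss_comp (ditruss_comp h g) f) erefl).

Definition InterchangeNearRingCat : category :=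
  @Category interchange_near_ring near_ring_hom near_ring_id near_ring_comp
    (fun A B f => @sig_eq _ _ (near_ring_comp (near_ring_id B) f) f erefl)
    (fun A B f => @sig_eq _ _ (near_ring_comp f (near_ring_id A)) f erefl)
    (fun A B C D h g f =>
       @sig_eq _ _ (near_ring_comp h (near_ring_comp g f))
         (near_ring_comp (near_ring_comp h g) f) erefl).

Definition lambda (T : left_ditruss) (a : T) : T -> T := fun b => tdot a b.

Definition lambda_constant_morphism (T : left_ditruss) : Prop :=
  [/\ forall a : T, group_endomorphism (lambda a),
      forall a b : T, lambda (tcirc a b) = lambda a \o lambda b
    & forall a b : T, lambda a = lambda b].

Definition interchange_ditruss (T : left_ditruss) : Prop :=
  [/\ associative (@tcirc T),
      lambda_constant_morphism T,
      idempotent_endomorphism (@sigma T),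
      idempotent_endomorphism (lambda (0 : T))
    & image_commuting (@sigma T) (lambda (0 : T))].

Definition associative_near_ring (G : interchange_near_ring) : Prop :=
  associative (@ncirc G).

Definition InterchangeDitrussCat : category :=
  @full_subcategory DitrussCat interchange_ditruss.

Definition AssociativeNearRingCat : category :=
  @full_subcategory InterchangeNearRingCat associative_near_ring.

(* Main.v *)
From Stdlib Require Import FunctionalExtensionality ProofIrrelevance.
From mathcomp Require Import ssreflect ssrfun ssrbool.
Require Import Defs.

Set Implicit Arguments.
Unset Strict Implicit.
Unset Printing Implicit Defensive.

(** In an interchange near-ring, writing the pair [(a, b)] once as
    [(a + 0, 0 + b)] and once as [(0 + a, b + 0)] splits the product in both
    orders, [a o b = (a o 0) + (0 o b) = (0 o b) + (a o 0)].  So the product is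
    carried by the two group endomorphisms [a |-> a o 0] and [b |-> 0 o b],
    whose images commute; when [o] is associative they are idempotent because
    [0 o 0 = 0]; for a constant [lambda], idempotence is also what makes it a
    semigroup morphism.  The two endomorphisms are [sigma] and the constant
    value of [lambda] in a left ditruss whose [tcirc] is the given product.  Conversely, if [sigma]
    and [lambda_0] are image-commuting endomorphisms and [lambda] is constant,
    then [tcirc a b = sigma a + tdot 0 b] satisfies the interchange law, and
    [sigma] and [tdot] are recovered as [tcirc a 0] and [tcirc 0 b].

    Both passages keep the group, the operation [o] and the underlying map of
    each morphism.  The round trips therefore return structures with equal
    operations on the same group.  These structures are equal but not
    convertible, so equality of functors is reduced, in [functor_ext], to a
    naturality square of the morphisms induced by equalities of objects; those
    morphisms have the identity as underlying map, so the squares commute. *)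

Local Open Scope agroup_scope.

(** * Equality of functors *)

Definition hom_of_eq (C : category) (A B : C) (e : A = B) : hom A B :=
  match e with erefl => idm A end.

(** Comparing [fmap F f] with [fmap G f] needs a transport along the equalities
    of objects; composing with [hom_of_eq] performs it inside the category, so
    that in a concrete category it can be computed on elements. *)
Lemma functor_ext (C D : category) (F G : functor C D)
    (e : forall A : C, F A = G A) :
  (forall (A B : C) (f : hom A B),
     compm (hom_of_eq (e B)) (fmap F f) = compm (fmap G f) (hom_of_eq (e A))) ->
  F = G.
Proof.
case: F e => F mF F1 FM; case: G => G mG G1 GM /= e.
have eFG : F = G by apply: functional_extensionality.
case: G / eFG mG G1 GM e => mG G1 GM e natural.
have emFG : mF = mG.
  apply: functional_extensionality_dep => A.
  apply: functional_extensionality_dep => B.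
  apply: functional_extensionality => f; move: (natural A B f).
  by rewrite !(proof_irrelevance _ (e _) erefl) /= compm_idl compm_idr.
case: mG / emFG {natural} G1 GM => G1 GM.
by rewrite (proof_irrelevance _ F1 G1) (proof_irrelevance _ FM GM).
Qed.

(** * Groups *)

Lemma add_idem_eq0 (G : group) (x : G) : x + x = x -> x = 0.
Proof. by move=> xx; rewrite -[LHS]add0l -(addNl x) -addA xx. Qed.

Lemma additive0 (G H : group) (f : G -> H) :
  (forall x y, f (x + y) = f x + f y) -> f 0 = 0.
Proof. by move=> fD; apply: add_idem_eq0; rewrite -fD add0l. Qed.

Lemma additiveN (G H : group) (f : G -> H) :
  (forall x y, f (x + y) = f x + f y) -> forall x, f (- x) = - f x.
Proof.
move=> fD x; rewrite -[LHS]add0r -(addNr (f x)) addA -fD addNl.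
by rewrite (additive0 fD) add0l.
Qed.

(** * From interchange near-rings to left ditrusses *)

Lemma ncirc00 (G : interchange_near_ring) : ncirc (0 : G) 0 = 0.
Proof. by apply: add_idem_eq0; rewrite -ncirc_interchange !add0l. Qed.

Lemma ncirc_split (G : interchange_near_ring) (a b : G) :
  ncirc a 0 + ncirc 0 b = ncirc a b.
Proof. by rewrite -ncirc_interchange add0l add0r. Qed.

Lemma ncirc_splitC (G : interchange_near_ring) (a b : G) :
  ncirc 0 b + ncirc a 0 = ncirc a b.
Proof. by rewrite -ncirc_interchange add0l add0r. Qed.

Definition ditruss_of_near_ring (G : interchange_near_ring) : left_ditruss :=
  @LeftDitruss G (fun a => ncirc a 0) (@ncirc G) (fun _ b => ncirc 0 b)
    (@ncirc_split G).

Lemma ditruss_of_near_ringP (G : interchange_near_ring) :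
  associative_near_ring G -> interchange_ditruss (ditruss_of_near_ring G).
Proof.
move=> ncircA.
have lD : group_endomorphism (fun b : G => ncirc 0 b).
  by move=> x y; rewrite -ncirc_interchange add0l.
have lK (b : G) : ncirc 0 (ncirc 0 b) = ncirc 0 b by rewrite ncircA ncirc00.
have sK (a : G) : ncirc (ncirc a 0) 0 = ncirc a 0 by rewrite -ncircA ncirc00.
split=> //.
- split=> // a b; apply: functional_extensionality => x.
  by rewrite /= /lambda /= lK.
- by split=> // x y; rewrite /= -ncirc_interchange add0l.
- by move=> x y; rewrite /= /lambda /= ncirc_split ncirc_splitC.
Qed.

Lemma ditruss_morphism_of_near_ring (G H : interchange_near_ring) (f : G -> H) :
  near_ring_morphism f ->
  @ditruss_morphism (ditruss_of_near_ring G) (ditruss_of_near_ring H) f.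
Proof.
move=> [fD fM]; have f0 := additive0 fD.
by split=> //= *; rewrite ?fM ?f0 ?(additiveN fD).
Qed.

(** * From left ditrusses to interchange near-rings *)

Section InterchangeDitruss.

Variables (T : left_ditruss) (interchangeT : interchange_ditruss T).

Lemma tdot_const (a b : T) : tdot a b = tdot 0 b.
Proof.
case: interchangeT => _ [_ _ lC] _ _ _.
exact: (congr1 (fun l => l b) (lC a 0)).
Qed.

Lemma tcircE (a b : T) : tcirc a b = sigma a + tdot 0 b.
Proof. by rewrite -ditrussE tdot_const. Qed.

Lemma tcirc0r (a : T) : tcirc a 0 = sigma a.
Proof.
case: interchangeT => _ _ _ [lD _] _.
by rewrite tcircE -/(lambda 0 0) (additive0 lD) add0r.
Qed.

Lemma tcirc0l (a b : T) : tcirc 0 b = tdot a b.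
Proof.
case: interchangeT => _ _ [sD _] _ _.
by rewrite tcircE (additive0 sD) add0l (tdot_const a).
Qed.

Lemma tcirc_interchange (w x y z : T) :
  tcirc (w + x) (y + z) = tcirc w y + tcirc x z.
Proof.
case: interchangeT => _ _ [sD _] [lD _] slC.
rewrite !tcircE sD -/(lambda 0 (y + z)) lD.
(* Image-commutation exchanges the two inner terms. *)
by rewrite -!addA; congr (_ + _); rewrite !addA slC.
Qed.

Definition near_ring_of_ditruss : interchange_near_ring :=
  InterchangeNearRing tcirc_interchange.

Lemma near_ring_of_ditrussP : associative_near_ring near_ring_of_ditruss.
Proof. by case: interchangeT. Qed.

End InterchangeDitruss.

Lemma near_ring_morphism_of_ditruss (S T : left_ditruss)
    (iS : interchange_ditruss S) (iT : interchange_ditruss T) (f : S -> T) :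
  ditruss_morphism f ->
  @near_ring_morphism (near_ring_of_ditruss iS) (near_ring_of_ditruss iT) f.
Proof. by case. Qed.

(** * The two functors *)

Definition to_near_ring_obj (T : InterchangeDitrussCat) :
    AssociativeNearRingCat :=
  exist _ (near_ring_of_ditruss (svalP T)) (@near_ring_of_ditrussP _ (svalP T)).

Definition to_near_ring_map (S T : InterchangeDitrussCat) (f : hom S T) :
    hom (to_near_ring_obj S) (to_near_ring_obj T) :=
  exist _ (sval f)
    (near_ring_morphism_of_ditruss (svalP S) (svalP T) (svalP f)).

Definition to_near_ring : functor InterchangeDitrussCat AssociativeNearRingCat :=
  @Functor InterchangeDitrussCat AssociativeNearRingCat
    to_near_ring_obj to_near_ring_map
    (fun A =>
       @sig_eq _ _ (to_near_ring_map (idm A)) (idm (to_near_ring_obj A)) erefl)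
    (fun A B C g f =>
       @sig_eq _ _ (to_near_ring_map (compm g f))
         (compm (to_near_ring_map g) (to_near_ring_map f)) erefl).

Definition to_ditruss_obj (G : AssociativeNearRingCat) : InterchangeDitrussCat :=
  exist _ (ditruss_of_near_ring (sval G)) (ditruss_of_near_ringP (svalP G)).

Definition to_ditruss_map (G H : AssociativeNearRingCat) (f : hom G H) :
    hom (to_ditruss_obj G) (to_ditruss_obj H) :=
  exist _ (sval f) (ditruss_morphism_of_near_ring (svalP f)).

Definition to_ditruss : functor AssociativeNearRingCat InterchangeDitrussCat :=
  @Functor AssociativeNearRingCat InterchangeDitrussCat
    to_ditruss_obj to_ditruss_map
    (fun A =>
       @sig_eq _ _ (to_ditruss_map (idm A)) (idm (to_ditruss_obj A)) erefl)
    (fun A B C g f =>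
       @sig_eq _ _ (to_ditruss_map (compm g f))
         (compm (to_ditruss_map g) (to_ditruss_map f)) erefl).

(** * The round trips *)

(** Equal operations on one group give equal objects, and the morphism induced
    by this equality is the identity on elements.  The second half is what the
    squares of [functor_ext] require, and it only makes sense because the two
    carriers are convertible. *)
Lemma ditruss_eq (G : group) (s s' : G -> G) (c c' d d' : G -> G -> G)
    (sdc : forall a b, s a + d a b = c a b)
    (sdc' : forall a b, s' a + d' a b = c' a b)
    (i : interchange_ditruss (LeftDitruss sdc))
    (i' : interchange_ditruss (LeftDitruss sdc')) :
  s =1 s' -> c =2 c' -> d =2 d' ->
  exists e : exist _ _ i = exist _ _ i' :> InterchangeDitrussCat,
    forall x : G, sval (hom_of_eq e) x = x.
Proof.
move=> /functional_extensionality es ec ed.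
have {}ec : c = c' by do 2 (apply: functional_extensionality => ?); apply: ec.
have {}ed : d = d' by do 2 (apply: functional_extensionality => ?); apply: ed.
case: s' / es sdc' i' => sdc' i'; case: c' / ec sdc' i' => sdc' i'.
case: d' / ed sdc' i' => sdc' i'.
case: sdc' / (proof_irrelevance _ sdc sdc') i' => i'.
case: i' / (proof_irrelevance _ i i').
by exists erefl.
Qed.

Lemma near_ring_eq (G : group) (c : G -> G -> G)
    (cI cI' : forall w x y z, c (w + x) (y + z) = c w y + c x z)
    (i : associative_near_ring (InterchangeNearRing cI))
    (i' : associative_near_ring (InterchangeNearRing cI')) :
  exists e : exist _ _ i = exist _ _ i' :> AssociativeNearRingCat,
    forall x : G, sval (hom_of_eq e) x = x.
Proof.
case: cI' / (proof_irrelevance _ cI cI') i' => i'.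
case: i' / (proof_irrelevance _ i i').
by exists erefl.
Qed.

Lemma to_near_ringK (T : InterchangeDitrussCat) :
  exists e : to_ditruss (to_near_ring T) = T,
    forall x : sval T, sval (hom_of_eq e) x = x.
Proof.
case: T => [[G s c d sdc] i]; apply: ditruss_eq => // [a | a b].
  exact: (tcirc0r i).
exact: (tcirc0l i).
Qed.

Lemma to_ditrussK (G : AssociativeNearRingCat) :
  exists e : to_near_ring (to_ditruss G) = G,
    forall x : sval G, sval (hom_of_eq e) x = x.
Proof. by case: G => [[G c cI] i]; apply: near_ring_eq. Qed.

Theorem theorem4p3 :
  isomorphic_categories InterchangeDitrussCat AssociativeNearRingCat.
Proof.
exists to_near_ring, to_ditruss; split.
- apply: (@functor_ext _ _ (functor_comp to_ditruss to_near_ring)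
    (functor_id _) (fun T => ex_proj1 (to_near_ringK T))) => S T f.
  apply: sig_eq; apply: functional_extensionality => x.
  by rewrite /= (ex_proj2 (to_near_ringK T)) (ex_proj2 (to_near_ringK S)).
- apply: (@functor_ext _ _ (functor_comp to_near_ring to_ditruss)
    (functor_id _) (fun G => ex_proj1 (to_ditrussK G))) => G H f.
  apply: sig_eq; apply: functional_extensionality => x.
  by rewrite /= (ex_proj2 (to_ditrussK H)) (ex_proj2 (to_ditrussK G)).
Qed.
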